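(* Given $s\times s$ symmetric positive definite matrices $\bar{\mathbf{Y}}$, $\mathbf{Y}_B$ and a parameter $\theta>0$ such that $2\mathbf{Y}_B+\theta\bar{\mathbf{Y}}\succ0$, the function $$\mathcal{J}(\mathbf{H})=\mathcal{L}(\mathbf{H}\mathbf{Y}_B,\mathbf{I})+\mathcal{L}(\mathbf{Y}_B\mathbf{H},\mathbf{I})+\theta\,\mathcal{L}(\mathbf{H},\bar{\mathbf{Y}}^{-1})$$ is strictly convex on the cone $\mathbb{C}^s_+$ of $s\times s$ symmetric positive definite matrices. If a solution of $\min_{\mathbf{H}\in\mathbb{C}^s_+}\mathcal{J}(\mathbf{H})$ exists, then it is the unique global minimiser $$\mathbf{H}^\star=(2+\theta)\bigl(2\mathbf{Y}_B+\theta\bar{\mathbf{Y}}\bigr)^{-1}.$$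
   Context: $\mathcal{L}$ denotes Stein's loss, given by the formula $\mathcal{L}(\mathbf{A},\mathbf{B})=\mathrm{Tr}(\mathbf{A}\mathbf{B}^{-1})-\log\det(\mathbf{A}\mathbf{B}^{-1})-s$ for $s\times s$ matrices; the same formula is used for the arguments $\mathbf{A}=\mathbf{H}\mathbf{Y}_B$ and $\mathbf{A}=\mathbf{Y}_B\mathbf{H}$, $\mathbf{B}=\mathbf{I}$, which need not be symmetric but have positive determinant when $\mathbf{H},\mathbf{Y}_B\succ0$. $\mathbf{A}\succ0$ means symmetric positive definite. *)

(* Defs.v *)
From mathcomp Require Import all_boot all_order all_algebra.
From mathcomp Require Import boolp classical_sets reals exp convex.

Set Implicit Arguments.
Unset Strict Implicit.
Unset Printing Implicit Defensive.

Import Order.TTheory GRing.Theory Num.Theory.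
Local Open Scope classical_set_scope.
Local Open Scope ring_scope.

Definition posdefmx (R : realType) (s : nat) (A : 'M[R]_s) : Prop :=
  A^T = A /\ forall x : 'cV[R]_s, x != 0 -> 0 < (x^T *m A *m x) 0 0.

Definition posdef_cone (R : realType) (s : nat) : set 'M[R]_s :=
  [set A | posdefmx A].

(* Total on all pairs of matrices; it is Stein's loss only where B is
   invertible and \det (A B^-1) > 0 (otherwise invmx and ln return default
   values). Symmetry of A and B is not required. *)
Definition stein_loss (R : realType) (s : nat) (A B : 'M[R]_s) : R :=
  \tr (A *m invmx B) - ln (\det (A *m invmx B)) - s%:R.

Definition strictly_convex_on (R : realType) (E : lmodType R)
    (D : set E) (f : E -> R) : Prop :=
  convex_set D /\
  forall (x y : E) (t : R), D x -> D y -> x != y -> 0 < t -> t < 1 ->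
    f (t *: x + (1 - t) *: y) < t * f x + (1 - t) * f y.

Definition global_minimiser (R : realType) (E : Type)
    (D : set E) (f : E -> R) (x : E) : Prop :=
  D x /\ forall y : E, D y -> f x <= f y.

Definition J_fun (R : realType) (s : nat) (Ybar YB : 'M[R]_s) (theta : R)
    (H : 'M[R]_s) : R :=
  stein_loss (H *m YB) 1%:M + stein_loss (YB *m H) 1%:M
  + theta * stein_loss H (invmx Ybar).

(* Main.v *)
Require Import Defs.
From mathcomp Require Import all_boot all_order all_algebra.
From mathcomp Require Import boolp classical_sets reals exp convex.
From mathcomp Require Import ring lra.

(** Write [M := 2 YB + theta Ybar].  Up to an additive constant, [J H] is
    [tr (H M) - (2 + theta) ln det H] on the cone.  Everything follows from
    the strict Gibbs-type inequality [ln det A - ln det B < tr (A B^-1) - s]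
    for positive definite [A != B].  Congruence by [P] with [P B P^T = 1]
    reduces it to [B = 1], which is proved by induction on [s] through Schur
    complements and [ln x <= x - 1].  Applied at [B := t A1 + (1 - t) A2] it
    bounds both endpoint values and gives strict concavity of [ln det]; applied
    at [B := (2 + theta) M^-1] it says that [J B < J A]. *)

Set Implicit Arguments.
Unset Strict Implicit.
Unset Printing Implicit Defensive.

Import Order.TTheory GRing.Theory Num.Theory.
Local Open Scope classical_set_scope.
Local Open Scope ring_scope.

Lemma ln_lt_sub1 (R : realType) (x : R) : 0 < x -> x != 1 -> ln x < x - 1.
Proof.
move=> x0 x1; rewrite ltrBrDl -[ltRHS](@lnK R x)//.
by apply: expR_gt1Dx; rewrite ln_eq0.
Qed.

Lemma ln_le_sub1 (R : realType) (x : R) : 0 < x -> ln x <= x - 1.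
Proof.
move=> x0; have [->|/(ln_lt_sub1 x0)/ltW//] := eqVneq x 1.
by rewrite ln1 subrr.
Qed.

Lemma posdefmx_congr (R : realType) (s : nat) (A P : 'M[R]_s) :
  posdefmx A -> P \in unitmx -> posdefmx (P *m A *m P^T).
Proof.
move=> [symA posA] uP; split=> [|x x0].
  by rewrite !trmx_mul trmxK symA mulmxA.
rewrite [x^T *m _](_ : _ = (P^T *m x)^T *m A *m P^T); last first.
  by rewrite trmx_mul trmxK !mulmxA.
rewrite -mulmxA; apply: posA; apply: contra_neq x0 => Px0.
have uPt : P^T \in unitmx by rewrite unitmx_tr.
by rewrite -(mulKmx uPt x) Px0 mulmx0.
Qed.

Lemma posdefmx_block_diag (R : realType) (m n : nat)
    (A : 'M[R]_m) (D : 'M[R]_n) :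
  posdefmx (block_mx A 0 0 D) -> posdefmx A /\ posdefmx D.
Proof.
move=> [symAD posAD]; move: symAD; rewrite tr_block_mx !trmx0.
move=> /eq_block_mx[symA _ _ symD]; split; split=> // x x0.
- have := posAD (col_mx x 0).
  rewrite tr_col_mx trmx0 mul_row_block mul_row_col !mul0mx !mulmx0 !addr0.
  by apply; rewrite col_mx_eq0 negb_and x0.
- have := posAD (col_mx 0 x).
  rewrite tr_col_mx trmx0 mul_row_block mul_row_col !mul0mx !mulmx0 !add0r.
  by apply; rewrite col_mx_eq0 negb_and x0 orbT.
Qed.

Lemma posdefmx_scalar1 (R : realType) (a : R) :
  posdefmx (a%:M : 'M_1) -> 0 < a.
Proof.
move=> [_ /(_ 1%:M)]; rewrite trmx1 mul1mx mulmx1 mxE eqxx mulr1n.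
by apply; rewrite oner_neq0.
Qed.

(** One step of symmetric Gaussian elimination: congruence by this unit lower triangular matrix
    clears [v] and [v^T] next to the pivot [a] and leaves a Schur complement. *)
Definition elim_mx (R : realType) (n : nat) (a : R) (v : 'rV[R]_n) :
    'M[R]_(1 + n) :=
  block_mx 1%:M 0 (- a^-1 *: v^T) 1%:M.

Lemma det_elim_mx (R : realType) (n : nat) (a : R) (v : 'rV[R]_n) :
  \det (elim_mx a v) = 1.
Proof. by rewrite det_lblock !det1 mulr1. Qed.

Lemma elim_mx_congr (R : realType) (n : nat) (a : R) (v : 'rV[R]_n)
    (D : 'M[R]_n) : a != 0 ->
  elim_mx a v *m block_mx a%:M v v^T D *m (elim_mx a v)^T =
  block_mx a%:M 0 0 (D - a^-1 *: (v^T *m v)).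
Proof.
move=> a0; rewrite /elim_mx tr_block_mx !mulmx_block !trmx1 trmx0.
rewrite !mul1mx !mul0mx !mulmx1 !mulmx0 !addr0 linearZ/= trmxK.
rewrite mul_scalar_mx mul_mx_scalar !scalerA mulrN divff// scaleN1r addNr.
by rewrite scaleN1r !addNr mul0mx add0r scaleNr mulNmx -scalemxAl addrC.
Qed.

(** The pivot is the quadratic form at the first basis vector. Congruence by [elim_mx] keeps
    positive definiteness and makes the matrix block diagonal, so the Schur complement inherits
    it. *)
Lemma posdefmx_schur (R : realType) (n : nat) (A : 'M[R]_(1 + n)) :
  posdefmx A -> exists a v D, [/\ A = block_mx a%:M v v^T D, 0 < a &
    posdefmx (D - a^-1 *: (v^T *m v))].
Proof.
move=> pA; exists (A 0 0), (ursubmx A), (drsubmx A).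
have eqA : A = block_mx (A 0 0)%:M (ursubmx A) (ursubmx A)^T (drsubmx A).
  rewrite -{1}[A]submxK trmx_ursub pA.1 [ulsubmx A]mx11_scalar !mxE.
  by congr (block_mx (A _ _)%:M _ _ _); apply: val_inj.
have a0 : 0 < A 0 0.
  have := pA.2 (col_mx 1%:M 0).
  rewrite {1}eqA tr_col_mx mul_row_block mul_row_col trmx0 trmx1.
  rewrite !mul0mx !mulmx0 !addr0 mul1mx mulmx1 [(_%:M) _ _]mxE eqxx mulr1n.
  by apply; rewrite col_mx_eq0 negb_and oner_neq0.
split=> //; set v := ursubmx A; set D := drsubmx A.
have /(posdefmx_congr pA) : elim_mx (A 0 0) v \in unitmx.
  by rewrite unitmxE det_elim_mx unitr1.
by rewrite {2}eqA elim_mx_congr ?gt_eqF// => /posdefmx_block_diag[].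
Qed.

(** Cholesky by induction: eliminate the first row and column, scale the pivot [a] to 1 by
    [1 / sqrt a], and treat the Schur complement with the [Q] of the induction hypothesis. In effect
    [P] is the inverse of a Cholesky factor. *)
Lemma posdefmx_congr1 (R : realType) (s : nat) (B : 'M[R]_s) :
  posdefmx B -> exists2 P, P \in unitmx & P *m B *m P^T = 1%:M.
Proof.
elim: s B => [|n IHn] B pB.
  by exists 1%:M; [exact: unitmx1 | apply/matrixP => -[]].
have [a [v [D [-> a0 /IHn[Q uQ QSQ]]]]] := posdefmx_schur pB.
pose b : 'M[R]_1 := (Num.sqrt a)^-1%:M.
pose E : 'M[R]_(1 + n) := block_mx b 0 0 Q.
have dE : \det E = (Num.sqrt a)^-1 * \det Q by rewrite det_ublock det_scalar1.
exists (E *m elim_mx a v).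
  rewrite unitmx_mul !unitmxE det_elim_mx unitr1 andbT dE.
  by rewrite unitrM -(unitmxE Q) uQ andbT unitfE invr_eq0 sqrtr_eq0 -ltNge.
transitivity (E *m (elim_mx a v *m block_mx a%:M v v^T D *m (elim_mx a v)^T)
              *m E^T); first by rewrite trmx_mul !mulmxA.
rewrite elim_mx_congr ?gt_eqF// tr_block_mx !mulmx_block.
rewrite !trmx0 !mul0mx !mulmx0 !addr0 !mul0mx !add0r QSQ.
have -> : b *m a%:M *m b^T = 1%:M.
  rewrite tr_scalar_mx -!scalar_mxM mulrAC -invfM -expr2 sqr_sqrtr ?ltW//.
  by rewrite mulVf ?gt_eqF.
by rewrite (scalar_mx_block 1 n).
Qed.

Lemma posdefmx_det_gt0 (R : realType) (s : nat) (A : 'M[R]_s) :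
  posdefmx A -> 0 < \det A.
Proof.
move=> /posdefmx_congr1[P uP] /(congr1 determinant).
(* The congruence gives [(\det P)^2 * \det A = 1], with a positive square. *)
rewrite !det_mulmx det_tr det1 mulrAC -expr2 => eq1.
by rewrite -(pmulr_rgt0 _ (x := \det P ^+ 2)) ?eq1// exprn_even_gt0//= -unitfE.
Qed.

Lemma posdefmx_unit (R : realType) (s : nat) (A : 'M[R]_s) :
  posdefmx A -> A \in unitmx.
Proof. by move=> /posdefmx_det_gt0 dA; rewrite unitmxE unitfE gt_eqF. Qed.

Lemma posdefmx_inv (R : realType) (s : nat) (A : 'M[R]_s) :
  posdefmx A -> posdefmx (invmx A).
Proof.
move=> pA; have uA := posdefmx_unit pA.
have := posdefmx_congr pA (P := invmx A); rewrite unitmx_inv mulVmx// mul1mx.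
by rewrite trmx_inv pA.1; apply.
Qed.

Lemma posdefmxD (R : realType) (s : nat) (A B : 'M[R]_s) :
  posdefmx A -> posdefmx B -> posdefmx (A + B).
Proof.
move=> [sA pA] [sB pB]; split=> [|x x0]; first by rewrite linearD/= sA sB.
by rewrite mulmxDr mulmxDl mxE addr_gt0 ?pA ?pB.
Qed.

Lemma posdefmxZ (R : realType) (s : nat) (c : R) (A : 'M[R]_s) :
  0 < c -> posdefmx A -> posdefmx (c *: A).
Proof.
move=> c0 [sA pA]; split=> [|x x0]; first by rewrite linearZ/= sA.
by rewrite -scalemxAr -scalemxAl mxE mulr_gt0 ?pA.
Qed.

Lemma ln_det_lt_trace_sub (R : realType) (s : nat) (C : 'M[R]_s) :
  posdefmx C -> C != 1%:M -> ln (\det C) < \tr C - s%:R.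
Proof.
(* In size 0 the only matrix is the identity, which [C != 1%:M] excludes. *)
elim: s C => [|n IHn] C pC; first by case/eqP; apply/matrixP => -[].
have [a [v [D [-> a0 pS]]]] := posdefmx_schur pC.
set S := D - _ in pS *.
have a_neq0 : a != 0 by rewrite gt_eqF.
have dS := posdefmx_det_gt0 pS.
have -> : \det (block_mx a%:M v v^T D) = a * \det S.
  have /(congr1 determinant) := elim_mx_congr v D a_neq0.
  by rewrite !det_mulmx det_tr det_elim_mx mul1r mulr1 det_ublock det_scalar1.
have eqD : D = S + a^-1 *: (v^T *m v) by rewrite subrK.
have vv : \tr (v^T *m v) = \sum_i v 0 i ^+ 2.
  by apply: eq_bigr => i _; rewrite mxE big_ord1 mxE.
have trC : \tr (block_mx a%:M v v^T D) =
    a + (\tr S + a^-1 * \sum_i v 0 i ^+ 2).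
  by rewrite mxtrace_block mxtrace_scalar eqD mxtraceD mxtraceZ vv.
have sum_ge0 : 0 <= a^-1 * \sum_i v 0 i ^+ 2.
  rewrite mulr_ge0 ?invr_ge0 ?(ltW a0)// sumr_ge0// => i _; exact: sqr_ge0.
(* The claim is now the sum of [ln a <= a - 1], the inductive bound for [S], and
   [0 <= |v|^2 / a]. *)
rewrite trC lnM ?posrE// -natr1 => C1.
have lnS : ln (\det S) <= \tr S - n%:R.
  have [->|/(IHn _ pS)/ltW//] := eqVneq S 1%:M.
  by rewrite det1 ln1 mxtrace_scalar subrr.
have lna := ln_le_sub1 a0.
(* One of the three must be strict: equality throughout means [a = 1], [S = 1] and [v = 0], that is,
   [C = 1]. *)
have [a1|/(ln_lt_sub1 a0)] := eqVneq a 1; last by lra.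
have [S1|/(IHn _ pS)] := eqVneq S 1%:M; last by lra.
have [v0|v_neq0] := eqVneq v 0.
  move/eqP: C1; case.
  rewrite eqD a1 S1 v0 trmx0 mul0mx scaler0 addr0.
  by rewrite (scalar_mx_block 1 n).
suff : 0 < a^-1 * \sum_i v 0 i ^+ 2 by lra.
rewrite lt_neqAle sum_ge0 andbT eq_sym mulf_neq0 ?invr_eq0//.
apply: contra_neq v_neq0 => /psumr_eq0P v0; apply/rowP => i; rewrite mxE.
by apply/eqP; rewrite -sqrf_eq0 v0// => j _; rewrite sqr_ge0.
Qed.

Lemma ln_det_sub_lt (R : realType) (s : nat) (A B : 'M[R]_s) :
  posdefmx A -> posdefmx B -> A != B ->
  ln (\det A) - ln (\det B) < \tr (A *m invmx B) - s%:R.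
Proof.
move=> pA pB AB; have [P uP PBP] := posdefmx_congr1 pB.
have uPt : P^T \in unitmx by rewrite unitmx_tr.
have eqB : B = invmx P *m invmx P^T.
  by rewrite -[invmx P]mulmx1 -PBP !mulmxA mulVmx// mul1mx mulmxK.
(* [P A P^T = 1 = P B P^T] would force [A = B], since [P] is invertible. *)
have PA1 : P *m A *m P^T != 1%:M.
  apply: contra_neq AB => PAP; rewrite eqB -[invmx P]mulmx1 -PAP.
  by rewrite !mulmxA mulVmx// mul1mx mulmxK.
have := ln_det_lt_trace_sub (posdefmx_congr pA uP) PA1.
have -> : \tr (P *m A *m P^T) = \tr (A *m invmx B).
  have -> : invmx B = P^T *m P.
    have BPP : B *m (P^T *m P) = 1%:M by rewrite eqB mulmxA mulmxKV// mulVmx.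
    by rewrite -(mulKmx (posdefmx_unit pB) (P^T *m P)) BPP mulmx1.
  by rewrite -mulmxA mxtrace_mulC mulmxA.
have dA := posdefmx_det_gt0 pA; have dB := posdefmx_det_gt0 pB.
(* Taking determinants in [P B P^T = 1] gives [(\det P)^2 = 1 / \det B]. *)
suff -> : \det (P *m A *m P^T) = \det A / \det B by rewrite ln_div.
apply: (canRL (mulfK _)); first by rewrite gt_eqF.
have /(congr1 determinant) := PBP.
rewrite !det_mulmx det1 => eq1; rewrite -[RHS]mulr1 -eq1; ring.
Qed.

Lemma ln_det_strictly_concave (R : realType) (s : nat) (A B : 'M[R]_s) (t : R) :
  posdefmx A -> posdefmx B -> A != B -> 0 < t -> t < 1 ->
  t * ln (\det A) + (1 - t) * ln (\det B) <
  ln (\det (t *: A + (1 - t) *: B)).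
Proof.
move=> pA pB AB t0 t1; have t1' : 0 < 1 - t by rewrite subr_gt0.
set Z := t *: A + _.
have pZ : posdefmx Z by apply: posdefmxD; apply: posdefmxZ.
have AZ : A != Z.
  apply: contra_neq AB => /(congr1 (fun X => X - t *: A)).
  rewrite /Z addrAC subrr add0r -{1}[A]scale1r -scalerBl.
  by apply: scalerI; rewrite gt_eqF.
have BZ : B != Z.
  apply: contra_neq AB => /(congr1 (fun X => X - (1 - t) *: B)).
  rewrite /Z addrK -{1}[B]scale1r -scalerBl subKr => /esym.
  by apply: scalerI; rewrite gt_eqF.
have := ln_det_sub_lt pA pZ AZ; have := ln_det_sub_lt pB pZ BZ.
rewrite -(ltr_pM2l t1') -(ltr_pM2l t0 (_ - _)) => ltB ltA.
(* In the weighted sum of the two bounds the traces add up to [\tr (Z Z^-1) = s], which cancels the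
   weighted constants [s]. *)
have := congr1 mxtrace (mulmxV (posdefmx_unit pZ)).
rewrite {1}/Z mulmxDl -!scalemxAl mxtraceD !mxtraceZ mxtrace_scalar -/Z.
move: ltA ltB; lra.
Qed.

Lemma stein_loss1 (R : realType) (s : nat) (A : 'M[R]_s) :
  stein_loss A 1%:M = \tr A - ln (\det A) - s%:R.
Proof. by rewrite /stein_loss invmx1 mulmx1. Qed.

(** Cyclicity of the trace merges the first two losses, and positive determinants let each logarithm
    split into a part in [H] and a constant. *)
Lemma J_funE (R : realType) (s : nat) (Ybar YB : 'M[R]_s) (theta : R)
    (H : 'M[R]_s) : posdefmx Ybar -> posdefmx YB -> posdefmx H ->
  J_fun Ybar YB theta H =
  \tr (H *m (2 *: YB + theta *: Ybar)) - (2 + theta) * ln (\det H)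
  - (2 * ln (\det YB) + theta * ln (\det Ybar) + (2 + theta) * s%:R).
Proof.
move=> /posdefmx_det_gt0 dY /posdefmx_det_gt0 dYB /posdefmx_det_gt0 dH.
rewrite /J_fun !stein_loss1 /stein_loss invmxK (mxtrace_mulC YB).
rewrite !det_mulmx !lnM ?posrE// mulmxDr -!scalemxAr mxtraceD !mxtraceZ.
ring.
Qed.

Theorem theorem6p1 (R : realType) (s : nat) (Ybar YB : 'M[R]_s) (theta : R)
    (hYbar : posdefmx Ybar) (hYB : posdefmx YB) (htheta : 0 < theta)
    (hsum : posdefmx (2 *: YB + theta *: Ybar)) :
  strictly_convex_on (@posdef_cone R s) (J_fun Ybar YB theta) /\
  ((exists H : 'M[R]_s,
      global_minimiser (@posdef_cone R s) (J_fun Ybar YB theta) H) ->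
   unique (global_minimiser (@posdef_cone R s) (J_fun Ybar YB theta))
     ((2 + theta) *: invmx (2 *: YB + theta *: Ybar))).
Proof.
have c0 : 0 < 2 + theta by rewrite addr_gt0.
set M := 2 *: YB + _ in hsum *.
split.
  split.
    apply/convex_setW => A B /[!inE] pA pB k k0 k1.
    rewrite inE; apply: (@posdefmxD R s); apply: posdefmxZ => //.
    by rewrite subr_gt0.
  move=> A B t pA pB AB t0 t1.
  have pZ : posdefmx (t *: A + (1 - t) *: B).
    by apply: posdefmxD; apply: posdefmxZ => //; rewrite subr_gt0.
  (* The trace term is linear in the argument, so the strict gap comes from [- (2 + theta) ln det]
     alone. *)
  rewrite !J_funE// -/M mulmxDl -!scalemxAl mxtraceD !mxtraceZ.
  have := ln_det_strictly_concave pA pB AB t0 t1.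
  rewrite -(ltr_pM2l c0); lra.
move=> _; set Hs := (2 + theta) *: invmx M.
have pHs : posdefmx Hs by apply: posdefmxZ => //; exact: posdefmx_inv.
have J_lt H : posdefmx H -> H != Hs ->
    J_fun Ybar YB theta Hs < J_fun Ybar YB theta H.
  move=> pH HHs; rewrite !J_funE// -/M.
  have := ln_det_sub_lt pH pHs HHs.
  (* Here [Hs^-1 = (2 + theta)^-1 M]. Multiplying the bound by [2 + theta] yields
     [\tr (H M) - (2 + theta) s], and [\tr (Hs M)] is exactly [(2 + theta) s]. *)
  rewrite invmxZ ?unitmxZ ?unitfE ?gt_eqF ?posdefmx_unit//; last first.
    exact: posdefmx_inv.
  rewrite invmxK -scalemxAr mxtraceZ -(ltr_pM2l c0) !mulrBr mulVKf ?gt_eqF//.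
  rewrite -scalemxAl mulVmx ?posdefmx_unit// mxtraceZ mxtrace_scalar; lra.
split.
  split=> // H pH; have [->//|/(J_lt _ pH)/ltW//] := eqVneq H Hs.
move=> H [pH minH]; apply/esym/eqP; apply: contraT => /(J_lt _ pH).
by rewrite ltNge minH.
Qed.
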